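(* Let $\mathrm{Corr}_{\mathrm{Gr}}$ be given by the following data: the objects ($0$-objects) are all groups; for two groups $G,F$, the $1$-morphisms from $G$ to $F$, forming $\mathrm{Corr}_{\mathrm{Gr}}(G,F)$, are the correspondences of groups $G\xleftarrow{p_1}S\xrightarrow{p_2}F$, where $S$ is a subgroup of $G\times F$; for two correspondences $S_1,S_2$ from $G$ to $F$, there is a $2$-morphism $S_1\Rightarrow S_2$ (which is then unique) exactly when $S_1\subset S_2$. With the composition $\copyright$ of $1$-morphisms, $\mathrm{Corr}_{\mathrm{Gr}}$ is a strict $2$-category; more precisely, it is a category enriched over poset-categories.
   Context: A correspondence of groups from $G$ to $F$ is a diagram $G\xleftarrow{p_1}S\xrightarrow{p_2}F$ where $S$ is a subgroup of $G\times F$ and $p_1,p_2$ are the restrictions to $S$ of the two projections; it is identified with the subgroup $S$. For correspondences $S\subset G\times F$ (from $G$ to $F$) and $S'\subset F\times K$ (from $F$ to $K$), the composition is the correspondence from $G$ to $K$ given by $$S'\copyright S:=\{(g,k)\in G\times K \mid \exists f\in F \text{ such that } (g,f)\in S \text{ and } (f,k)\in S'\}.$$ The identity $1$-morphism of $G$ is the diagonal $1_G=\Delta(G)=\{(g,g)\mid g\in G\}\subset G\times G$. A poset $(P,\le)$ is regarded as a (small) category (a poset-category) with exactly one morphism $x\to y$ if $x\le y$ and none otherwise; $\mathrm{Corr}_{\mathrm{Gr}}(G,F)$ is the poset-category of subgroups of $G\times F$ ordered by inclusion. Vertical composition of $2$-morphisms is composition of inclusions; the horizontal composition of $2$-morphisms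 $S_1\subset S_2$ (in $\mathrm{Corr}_{\mathrm{Gr}}(G,F)$) and $S_1'\subset S_2'$ (in $\mathrm{Corr}_{\mathrm{Gr}}(F,K)$) is the inclusion $S_1'\copyright S_1\subset S_2'\copyright S_2$. ''Strict'' means that composition of $1$-morphisms is associative and unital on the nose (by equalities). *)

(* Defs.v *)
From HB Require Import structures.
From mathcomp Require Import all_boot all_order.
From mathcomp Require Import boolp classical_sets.

Set Implicit Arguments.
Unset Strict Implicit.
Unset Printing Implicit Defensive.

Import Order.Theory.

Record category := Category {
  obj :> Type;
  mor : obj -> obj -> Type;
  idm : forall x, mor x x;
  compm : forall x y z, mor y z -> mor x y -> mor x z;
  compmA : forall w x y z (h : mor y z) (g : mor x y) (f : mor w x),
    compm h (compm g f) = compm (compm h g) f;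
  comp1m : forall x y (f : mor x y), compm (idm y) f = f;
  compm1 : forall x y (f : mor x y), compm f (idm x) = f
}.

Arguments mor {c} _ _.
Arguments idm {c} _.
Arguments compm {c x y z} _ _.

Record functor (C D : category) := Functor {
  fobj :> C -> D;
  fmor : forall x y, mor x y -> mor (fobj x) (fobj y);
  fmor1 : forall x, fmor (idm x) = idm (fobj x);
  fmorM : forall x y z (g : mor y z) (f : mor x y),
    fmor (compm g f) = compm (fmor g) (fmor f)
}.

Arguments fmor {C D} _ {x y} _.

Program Definition prod_category (C D : category) : category :=
  {| obj := (C * D)%type;
     mor p q := (mor p.1 q.1 * mor p.2 q.2)%type;
     idm p := (idm p.1, idm p.2);
     compm _ _ _ g f := (compm g.1 f.1, compm g.2 f.2) |}.
Next Obligation. by rewrite /= !compmA. Qed.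
Next Obligation. by rewrite /= !comp1m. Qed.
Next Obligation. by rewrite /= !compm1. Qed.

Program Definition id_functor (C : category) : functor C C :=
  {| fobj x := x; fmor _ _ f := f |}.

Program Definition comp_functor (C D E : category)
    (G : functor D E) (F : functor C D) : functor C E :=
  {| fobj x := G (F x); fmor _ _ f := fmor G (fmor F f) |}.
Next Obligation. by rewrite !fmor1. Qed.
Next Obligation. by rewrite !fmorM. Qed.

Program Definition const_functor (C D : category) (d : D) : functor C D :=
  {| fobj _ := d; fmor _ _ _ := idm d |}.
Next Obligation. by rewrite comp1m. Qed.

Program Definition fst_functor (C D : category) :
    functor (prod_category C D) C :=
  {| fobj p := p.1; fmor _ _ f := f.1 |}.

Program Definition snd_functor (C D : category) :
    functor (prod_category C D) D :=
  {| fobj p := p.2; fmor _ _ f := f.2 |}.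

Program Definition pair_functor (C D E : category)
    (F : functor C D) (G : functor C E) : functor C (prod_category D E) :=
  {| fobj x := (F x, G x); fmor _ _ f := (fmor F f, fmor G f) |}.
Next Obligation. by rewrite !fmor1. Qed.
Next Obligation. by rewrite !fmorM. Qed.

Definition prod_functor (C C' D D' : category)
    (F : functor C C') (G : functor D D') :
    functor (prod_category C D) (prod_category C' D') :=
  pair_functor (comp_functor F (fst_functor C D))
               (comp_functor G (snd_functor C D)).

Definition assoc_functor (C D E : category) :
    functor (prod_category (prod_category C D) E)
            (prod_category C (prod_category D E)) :=
  pair_functor
    (comp_functor (fst_functor C D) (fst_functor _ E))
    (pair_functor (comp_functor (snd_functor C D) (fst_functor _ E))
                  (snd_functor _ E)).

(* A strict 2-category, as a category enriched over Cat: [hom2 x y] has the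
   1-morphisms x -> y as objects and the 2-morphisms between them as morphisms
   (its composition is the vertical one); [hcomp] acts on 1-morphisms as their
   composition and on 2-morphisms as the horizontal composition, and its
   functoriality is the interchange law.  The axioms are Leibniz equalities of
   functors, hence hold on the nose both on 1- and on 2-morphisms. *)
Record strict_2category (ob : Type) (hom2 : ob -> ob -> category) :=
  Strict2Category {
  id1 : forall x, hom2 x x;
  hcomp : forall x y z,
    functor (prod_category (hom2 y z) (hom2 x y)) (hom2 x z);
  hcompA : forall w x y z,
    comp_functor (hcomp w x z)
      (prod_functor (hcomp x y z) (id_functor (hom2 w x))) =
    comp_functor (hcomp w y z)
      (comp_functor (prod_functor (id_functor (hom2 y z)) (hcomp w x y))
        (assoc_functor (hom2 y z) (hom2 x y) (hom2 w x)));
  hcomp1l : forall x y,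
    comp_functor (hcomp x y y)
      (pair_functor (const_functor (hom2 x y) (id1 y))
                    (id_functor (hom2 x y))) =
    id_functor (hom2 x y);
  hcomp1r : forall x y,
    comp_functor (hcomp x x y)
      (pair_functor (id_functor (hom2 x y))
                    (const_functor (hom2 x y) (id1 x))) =
    id_functor (hom2 x y)
}.

Arguments id1 {ob hom2} _ _.
Arguments hcomp {ob hom2} _ _ _ _.

Program Definition poset_category d (P : porderType d) : category :=
  {| obj := P;
     mor x y := is_true (x <= y)%O;
     idm x := lexx x;
     compm _ _ _ g f := le_trans f g |}.

Definition poset_enriched_category (ob : Type) d
    (hom : ob -> ob -> porderType d) :=
  strict_2category (fun x y => poset_category (hom x y)).

Record subgroup (G : groupType) := Subgroup {
  subgroup_set :> set G;
  _ : `[< group_closed [in subgroup_set] >]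
}.

HB.instance Definition _ (G : groupType) :=
  [isSub for @subgroup_set G].
HB.instance Definition _ (G : groupType) :=
  [Choice of subgroup G by <:].
HB.instance Definition _ (G : groupType) :=
  [SubChoice_isSubPOrder of subgroup G by <: with set_display].

Lemma le_subgroupE (G : groupType) (A B : subgroup G) :
  (A <= B)%O = `[< (A `<=` B)%classic >].
Proof. by []. Qed.

Definition corr (G F : groupType) : porderType set_display :=
  subgroup (G * F)%type.

(* Main.v *)
Require Import Defs.
From mathcomp Require Import all_boot all_order.
From mathcomp Require Import boolp classical_sets.

(** Relations of sets compose associatively, with diagonals as units, and
composition is monotone in both arguments.  Diagonals are subgroups, and
composites of subgroups are again subgroups because group elements that
witness two composed pairs can be divided ([subgroup_diagonal],
[subgroup_compose]).  So groups and correspondences form a category whose hom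
sets are posets and whose composition is monotone.

It remains to see that this amounts to an enrichment over poset-categories.
Two parallel morphisms of a poset-category are equal, hence a monotone map is
automatically a functor, and functors into a poset-category are determined by
their values on objects ([poset_functor_eq]).  All coherence conditions on
2-morphisms, the interchange law included, are therefore automatic, and the
axioms reduce to associativity and unitality of the composition of 1-morphisms
([poset_enriched_of_monotone]). *)

Set Implicit Arguments.
Unset Strict Implicit.
Unset Printing Implicit Defensive.

Import Order.Theory.

(** * Enrichment over poset-categories *)

(** The object maps being equal, the two morphism maps land in the same
inequalities, which have only one proof. *)
Lemma poset_functor_eq (C : category) d (P : porderType d)
    (F G : functor C (poset_category P)) :
  (forall x, F x = G x) -> F = G.
Proof.
case: F G => [Fo Fm F1 FM] [Go Gm G1 GM] /= /funext eqFG.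
case: Go / eqFG Gm G1 GM => Gm G1 GM.
have eqFGm : Fm = Gm.
  by do 3![apply: functional_extensionality_dep => ?]; exact: bool_irrelevance.
case: Gm / eqFGm G1 GM => G1 GM.
by congr Functor; exact: Prop_irrelevance.
Qed.

(** The functor laws equate two proofs of one inequality. *)
Definition monotone2_functor d1 d2 d3 (P : porderType d1) (Q : porderType d2)
    (R : porderType d3) (f : P -> Q -> R)
    (f_le : forall x x' y y',
      (x <= x')%O -> (y <= y')%O -> (f x y <= f x' y')%O) :
  functor (prod_category (poset_category P) (poset_category Q))
          (poset_category R) :=
  @Functor (prod_category (poset_category P) (poset_category Q))
    (poset_category R)
    (fun p => f p.1 p.2)
    (fun p q le_pq => f_le _ _ _ _ le_pq.1 le_pq.2)
    (fun _ => bool_irrelevance _ _)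
    (fun _ _ _ _ _ => bool_irrelevance _ _).

(** Only 1-morphisms carry information when homs are posets, so a category
with partially ordered hom sets and monotone composition is enough. *)
Definition poset_enriched_of_monotone (ob : Type) d
    (hom : ob -> ob -> porderType d)
    (one : forall x, hom x x)
    (comp : forall x y z, hom y z -> hom x y -> hom x z)
    (comp_le : forall x y z (g g' : hom y z) (f f' : hom x y),
      (g <= g')%O -> (f <= f')%O -> (comp x y z g f <= comp x y z g' f')%O)
    (compA : forall w x y z (h : hom y z) (g : hom x y) (f : hom w x),
      comp _ _ _ (comp _ _ _ h g) f = comp _ _ _ h (comp _ _ _ g f))
    (comp1l : forall x y (f : hom x y), comp _ _ _ (one y) f = f)
    (comp1r : forall x y (f : hom x y), comp _ _ _ f (one x) = f) :
  poset_enriched_category hom.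
Proof.
apply: (@Strict2Category ob (fun x y => poset_category (hom x y)) one
  (fun x y z => monotone2_functor (@comp_le x y z))).
- by move=> w x y z; apply: poset_functor_eq => p; exact: compA.
- by move=> x y; apply: poset_functor_eq => f; exact: comp1l.
- by move=> x y; apply: poset_functor_eq => f; exact: comp1r.
Defined.

(** * Correspondences of groups *)

(** Being a subgroup is recorded as a boolean, of which there is one proof. *)
Lemma subgroup_eq (G : groupType) (A B : subgroup G) :
  A = B :> set G -> A = B.
Proof. exact: val_inj. Qed.

(** Trades the boolean membership in [group_closed] for the propositional
one of relations, in both directions. *)
Lemma group_closedE (G : groupType) (A : set G) :
  group_closed [in A] <->
  A 1%g /\ (forall x y, A x -> A y -> A (x / y)%g).
Proof.
split=> -[A1 AV]; split.
- exact: set_mem A1.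
- by move=> x y Ax Ay; apply: set_mem; apply: AV; exact: mem_set.
- exact: mem_set.
- by move=> x y /set_mem Ax /set_mem Ay; apply: mem_set; exact: AV.
Qed.

Lemma subgroupP (G : groupType) (A : subgroup G) :
  (A : set G) 1%g /\
  (forall x y, (A : set G) x -> (A : set G) y -> (A : set G) (x / y)%g).
Proof. by apply/group_closedE; case: A => A /= /asboolP. Qed.

Lemma subgroup_diagonal (G : groupType) :
  group_closed [in @diagonal G].
Proof.
apply/group_closedE; split=> // -[x1 x2] [y1 y2].
by rewrite /diagonal /= => -> ->.
Qed.

(** If [f] links [g] to [k] and [f'] links [g'] to [k'], then [f / f'] links
[g / g'] to [k / k']. *)
Lemma subgroup_compose (G F K : groupType) (S' : corr F K) (S : corr G F) :
  group_closed
    [in ((S' : set (F * K)) \; (S : set (G * F)))%relation].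
Proof.
have [S1 SV] := subgroupP S; have [S'1 S'V] := subgroupP S'.
apply/group_closedE; split; first by exists 1%g.
move=> [g k] [g' k'] [f Sgf S'fk] [f' Sgf' S'fk'].
by exists (f / f')%g; [exact: SV Sgf Sgf' | exact: S'V S'fk S'fk'].
Qed.

Definition corr_id (G : groupType) : corr G G :=
  Subgroup (asboolT (@subgroup_diagonal G)).

Definition corr_comp (G F K : groupType) (S' : corr F K) (S : corr G F) :
    corr G K :=
  Subgroup (asboolT (subgroup_compose S' S)).

Lemma corr_comp_le (G F K : groupType) (S' T' : corr F K) (S T : corr G F) :
  (S' <= T')%O -> (S <= T)%O -> (corr_comp S' S <= corr_comp T' T)%O.
Proof.
move=> /asboolP S'T' /asboolP ST; apply/asboolP => x [f Sf S'f].
by exists f; [exact: ST | exact: S'T'].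
Qed.

Lemma corr_compA (G F K L : groupType)
    (S'' : corr K L) (S' : corr F K) (S : corr G F) :
  corr_comp (corr_comp S'' S') S = corr_comp S'' (corr_comp S' S).
Proof.
apply/subgroup_eq/seteqP; split=> x /=.
- by case=> f Sf [k S'fk S''k]; exists k => //; exists f.
- by case=> k [f Sf S'fk] S''k; exists f => //; exists k.
Qed.

Lemma corr_comp1l (G F : groupType) (S : corr G F) :
  corr_comp (corr_id F) S = S.
Proof.
apply/subgroup_eq/seteqP; split=> -[g f] /=.
- by case=> f' Sgf' /diagonalP <-.
- by exists f.
Qed.

Lemma corr_comp1r (G F : groupType) (S : corr G F) :
  corr_comp S (corr_id G) = S.
Proof.
apply/subgroup_eq/seteqP; split=> -[g f] /=.
- by case=> g' /diagonalP ->.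
- by exists g.
Qed.

Theorem theorem4p7 :
  exists C : poset_enriched_category corr,
    (forall G : groupType, id1 C G = diagonal :> set (G * G)) /\
    (forall (G F K : groupType) (S : corr G F) (S' : corr F K),
        hcomp C G F K (S', S) =
          ((S' : set (F * K)) \; (S : set (G * F)))%relation :> set (G * K)).
Proof.
by exists (poset_enriched_of_monotone
  corr_comp_le corr_compA corr_comp1l corr_comp1r).
Qed.
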